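(* Let $a,c$ be real numbers with $a\neq 0,1$ and $c\neq 0,-1,-2,\ldots$, and let $\mathcal F=(F_1,F_2)$ be a pair of finite sets of positive integers (not both empty) such that $\Omega_{\mathcal F}^{a,c}(n)\neq 0$ for all integers $n\ge 0$. Let $G_1=I(F_1)$, $G_2=I(F_2)$, let $m=|G_1|+|G_2|$, let $\tilde c=c+M_{F_1}+M_{F_2}+2$, and $r_j(x)=(\tilde c+x-m)_{m-j}\,(x-j+1)_j$ for $j=0,\ldots,m$. Then for every integer $n\ge v_{\mathcal F}$ there is a normalization constant $\beta_n$ (independent of $x$) such that $$m_n^{a,c;\mathcal F}(x)=\beta_n\det R_n(x),$$ where $R_n(x)$ is the $(m+1)\times(m+1)$ matrix with columns indexed by $j=0,\ldots,m$ whose rows are, from top to bottom: the row $\big(r_j(x)\,m_{n-v_{\mathcal F}}^{a,\tilde c}(x-j)\big)_j$; then, for each $g\in G_1$ in increasing order, the row $\big(a^j\,m_g^{a,2-\tilde c}(-x-1+j)\big)_j$; then, for each $g\in G_2$ in increasing order, the row $\big(m_g^{1/a,2-\tilde c}(-x-1+j)\big)_j$.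
   Context: $(y)_j=y(y+1)\cdots(y+j-1)$, $(y)_0=1$. Meixner polynomials: for $a\ne 0,1$, $m_n^{a,c}(x)=\frac{a^n}{(1-a)^n}\sum_{j=0}^n a^{-j}\binom{x}{j}\binom{-x-c}{n-j}$. For a finite set $F$ of positive integers, $M_F=\max F$, with $M_\emptyset=-1$; the involution $I$ is $I(F)=\{1,2,\ldots,M_F\}\setminus\{M_F-f: f\in F\}$ (so $I(\emptyset)=\emptyset$). For a pair $\mathcal F=(F_1,F_2)$ of finite sets of positive integers, let $k_i=|F_i|$, $k=k_1+k_2$, $$u_{\mathcal F}=\sum_{f\in F_1}f+\sum_{f\in F_2}f-\binom{k_1+1}{2}-\binom{k_2}{2},\qquad v_{\mathcal F}=u_{\mathcal F}+M_{F_1}+1 .$$ For $n\ge u_{\mathcal F}$ with $n-u_{\mathcal F}\notin F_1$ (in particular for every $n\ge v_{\mathcal F}$), $m_n^{a,c;\mathcal F}(x)$ is the determinant of the $(k+1)\times(k+1)$ matrix with columns indexed by $j=0,1,\ldots,k$ whose rows are, from top to bottom: $\big(m_{n-u_{\mathcal F}}^{a,c}(x+j)\big)_j$; then $\big(m_f^{a,c}(x+j)\big)_j$ for $f\in F_1$ (increasing order); then $\big(m_f^{1/a,c}(x+j)/a^j\big)_j$ for $f\in F_2$ (increasing order). $\Omega_{\mathcal F}^{a,c}(x)$ is the $k\times k$ determinant with columns indexed by $j=0,\ldots,k-1$ and rows $\big(m_f^{a,c}(x+j)\big)_j$ for $f\in F_1$ (increasing order), followed by $\big(m_f^{1/a,c}(x+j)/a^j\big)_j$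 for $f\in F_2$ (increasing order). *)

(* Defs.v *)
From mathcomp Require Import all_boot all_order all_algebra finmap reals.

Set Implicit Arguments.
Unset Strict Implicit.
Unset Printing Implicit Defensive.

Import Order.TTheory GRing.Theory Num.Theory.
Local Open Scope fset_scope.
Local Open Scope ring_scope.

(* (y)_j = y (y + 1) ... (y + j - 1) *)
Definition poch (K : fieldType) (y : K) (j : nat) : K :=
  \prod_(i < j) (y + i%:R).

(* binom(x, j) for a field element x *)
Definition gbinom (K : fieldType) (x : K) (j : nat) : K :=
  (\prod_(i < j) (x - i%:R)) / j`!%:R.

(* m_n^{a,c}(x) *)
Definition meixner (K : fieldType) (a c : K) (n : nat) (x : K) : K :=
  a ^+ n / (1 - a) ^+ n *
  \sum_(j < n.+1) a ^- j * gbinom x j * gbinom (- x - c) (n - j).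

(* M_F, with value -1 on the empty set *)
Definition maxF (F : {fset nat}) : int :=
  if F == fset0 then - 1 else (\max_(f <- F) f)%N%:Z.

(* The natural-number maximum of the empty set is 0, so that
   involF fset0 = fset0; the subtraction M - f is exact since f <= M. *)
Definition involF (F : {fset nat}) : {fset nat} :=
  let M := (\max_(f <- F) f)%N in
  [fset i in iota 1 M] `\` [fset (M - f)%N | f in F].

Definition uF (F1 F2 : {fset nat}) : int :=
  (\sum_(f <- F1) f)%N%:Z + (\sum_(f <- F2) f)%N%:Z
  - 'C(#|` F1| + 1, 2)%:Z - 'C(#|` F2|, 2)%:Z.

Definition vF (F1 F2 : {fset nat}) : int := uF F1 F2 + maxF F1 + 1.

(* The elements of F in increasing order *)
Definition incr (F : {fset nat}) : seq nat := sort leq F.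

(* The determinant of the square matrix whose i-th row is (nth i s j)_j;
   a row is represented as a function of its column index. *)
Definition det_rows (K : fieldType) (s : seq (nat -> K)) : K :=
  \det (\matrix_(i < size s, j < size s) nth (fun=> 0) s i j).

Definition casorati_rows (K : fieldType) (a c : K) (F1 F2 : {fset nat}) (x : K)
    : seq (nat -> K) :=
  [seq (fun j : nat => meixner a c f (x + j%:R)) | f <- incr F1] ++
  [seq (fun j : nat => meixner a^-1 c f (x + j%:R) / a ^+ j) | f <- incr F2].

(* Omega_F^{a,c}(x) *)
Definition OmegaF (K : fieldType) (a c : K) (F1 F2 : {fset nat}) (x : K) : K :=
  det_rows (casorati_rows a c F1 F2 x).

(* m_n^{a,c;F}(x); only meaningful for n >= u_F, where the absolute value of
   n - u_F is n - u_F. *)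
Definition meixnerF (K : fieldType) (a c : K) (F1 F2 : {fset nat}) (n : int)
    (x : K) : K :=
  det_rows ((fun j : nat => meixner a c `|n - uF F1 F2|%N (x + j%:R))
            :: casorati_rows a c F1 F2 x).

(* c + M_{F1} + M_{F2} + 2 *)
Definition ctilde (K : fieldType) (c : K) (F1 F2 : {fset nat}) : K :=
  c + (maxF F1)%:~R + (maxF F2)%:~R + 2.

(* r_j(x), with ct standing for the shifted parameter. For j <= m the
   natural-number subtraction m - j is exact. *)
Definition rfac (K : fieldType) (ct : K) (m j : nat) (x : K) : K :=
  poch (ct + x - m%:R) (m - j) * poch (x - j%:R + 1) j.

(* det R_n(x), for n >= v_F *)
Definition detR (K : fieldType) (a c : K) (F1 F2 : {fset nat}) (n : int)
    (x : K) : K :=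
  let G1 := involF F1 in
  let G2 := involF F2 in
  let m := (#|` G1| + #|` G2|)%N in
  let ct := ctilde c F1 F2 in
  det_rows
    ((fun j : nat => rfac ct m j x * meixner a ct `|n - vF F1 F2|%N (x - j%:R))
     :: [seq (fun j : nat => a ^+ j * meixner a (2 - ct) g (- x - 1 + j%:R))
        | g <- incr G1]
     ++ [seq (fun j : nat => meixner a^-1 (2 - ct) g (- x - 1 + j%:R))
        | g <- incr G2]).

(* Main.v *)
Require Import Defs.
From mathcomp Require Import all_boot all_order all_algebra all_fingroup finmap reals.
From mathcomp Require Import ring zify.
From mathcomp Require boolp.

(* The polynomial m_n^{a,c}(x) is the coefficient of z^n in
   (1 + z/(1-a))^x (1 + a z/(1-a))^{-x-c}, so with
   q = (1 + z/(1-a))/(1 + a z/(1-a)) the rows (m_f^{a,c}(x+j))_j and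
   (m_f^{1/a,c}(x+j)/a^j)_j list, on the basis q^j, Taylor coefficients at q = 1
   and at q = 1/a.  Appending n' = n - u_F to F_1 makes the left-hand side a
   minor of the confluent Vandermonde-like matrix of all seeds f <= n' and
   f <= M_{F_2}.  The residue pairing P, R |-> Res_oo P R / Z with
   Z = (q-1)^{n'+1} (q-1/a)^{M_{F_2}+1} identifies the inverse of that matrix
   with seeds of reversed index and reflected parameters, and Jacobi's identity
   turns the minor into the Casoratian, at -x, of the complementary seeds
   {1,...,p}, p + 1 + G_1 and G_2, where p = n - v_F.

   None of these indices is the 0 of the first family, so every row is the image
   under one bidiagonal matrix (the derivative of the generating function) of a
   row whose index is lowered by one in the first family.  The left kernel of
   that matrix becomes an additional row, and eliminating the seeds 0,...,p-1 by
   p differences turns it, by the Rodrigues formula, into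
   r_j(x) m_p^{a,c~}(x-j) up to factors a^{-j}. *)

Set Implicit Arguments.
Unset Strict Implicit.
Unset Printing Implicit Defensive.

Import Order.TTheory GRing.Theory Num.Theory.
Local Open Scope fset_scope.
Local Open Scope ring_scope.

(** * The generating function *)

Section Series.
Variable K : numFieldType.
Implicit Types (u v w : nat -> K) (x y al be : K) (n : nat).

Lemma natr_neq0 n : n.+1%:R != 0 :> K.
Proof. by rewrite pnatr_eq0. Qed.

Lemma factr_neq0 n : (n`!)%:R != 0 :> K.
Proof. by rewrite pnatr_eq0 -lt0n fact_gt0. Qed.

Lemma gbinom0 x : gbinom x 0 = 1.
Proof. by rewrite /gbinom big_ord0 divr1. Qed.

Lemma mul_gbinom_diag x n :
  n.+1%:R * gbinom x n.+1 = x * gbinom (x - 1) n.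
Proof.
rewrite /gbinom big_ord_recl subr0 factS natrM.
under eq_bigr => i _ do rewrite lift0 -natr1 opprD addrA (addrAC x).
by field; rewrite factr_neq0 addrC natr1 natr_neq0.
Qed.

Lemma gbinom_pascal x n :
  gbinom (x + 1) n.+1 = gbinom x n.+1 + gbinom x n.
Proof.
have E (i : nat) : x + 1 - i.+1%:R = x - i%:R by rewrite -natr1; ring.
rewrite /gbinom big_ord_recl subr0 [X in _ = X / _ + _]big_ord_recr factS natrM /=.
under eq_bigr => i _ do rewrite E.
by field; rewrite factr_neq0 addrC natr1 natr_neq0.
Qed.

Definition conv u v n : K := \sum_(j < n.+1) u j * v (n - j)%N.

(** Truncation to polynomials lets the laws of the Cauchy product come from [{poly K}]; one bound
    [k] serves all smaller degrees. *)
Lemma conv_coef u v n k : (n <= k)%N ->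
  conv u v n = ((\poly_(i < k.+1) u i) * (\poly_(i < k.+1) v i))`_n.
Proof.
move=> nk; rewrite coefM; apply: eq_bigr => j _.
by rewrite !coef_poly !ltnS (leq_trans _ nk) ?(leq_trans (leq_subr _ _) nk) // -ltnS.
Qed.

Lemma convC u v n : conv u v n = conv v u n.
Proof. by rewrite !(@conv_coef _ _ _ n) // mulrC. Qed.

Lemma convA u v w n : conv u (conv v w) n = conv (conv u v) w n.
Proof.
pose P t := \poly_(i < n.+1) t i : {poly K}.
have -> : conv u (conv v w) n = (P u * (P v * P w))`_n.
  rewrite coefM; apply: eq_bigr => j _.
  by rewrite coef_poly ltn_ord (@conv_coef _ _ _ n) ?leq_subr.
rewrite mulrA coefM; apply: eq_bigr => j _.
by rewrite coef_poly ltnS leq_subr (@conv_coef _ _ _ n) // -ltnS.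
Qed.

(** The coefficient of z^n in (1 + al z)^x; [binconv] then belongs to (1 + al z)^x (1 + be z)^y. *)
Definition binpow al x n : K := al ^+ n * gbinom x n.

Definition binconv al be x y : nat -> K := conv (binpow al x) (binpow be y).

Lemma binconvC al be x y n : binconv al be x y n = binconv be al y x n.
Proof. exact: convC. Qed.

Lemma binconv0 al be x y : binconv al be x y 0 = 1.
Proof. by rewrite /binconv /conv big_ord1 /binpow !gbinom0 !expr0 !mulr1. Qed.

(** Multiplication of the generating function by 1 + al z. *)
Lemma binconv_pascall al be x y n :
  binconv al be (x + 1) y n.+1 = binconv al be x y n.+1 + al * binconv al be x y n.
Proof.
rewrite /binconv /conv big_ord_recl [X in _ = X + _]big_ord_recl -addrA.
rewrite /binpow !gbinom0; congr (_ + _).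
rewrite mulr_sumr -big_split; apply: eq_bigr => j _.
by rewrite lift0 subSS gbinom_pascal exprS /=; ring.
Qed.

Lemma binconv_pascalr al be x y n :
  binconv al be x (y + 1) n.+1 = binconv al be x y n.+1 + be * binconv al be x y n.
Proof. by rewrite binconvC binconv_pascall !(binconvC be). Qed.

(** The operator z d/dz applied to the first factor only. *)
Lemma binconv_index al be x y n :
  \sum_(j < n.+2) j%:R * (binpow al x j * binpow be y (n.+1 - j)) =
  al * x * binconv al be (x - 1) y n.
Proof.
rewrite big_ord_recl mul0r add0r /binconv /conv mulr_sumr; apply: eq_bigr => j _.
rewrite lift0 subSS {1}/binpow.
rewrite mulrA (mulrCA _ (al ^+ _)) mul_gbinom_diag exprS /binpow; ring.
Qed.

Lemma binconv_deriv al be x y n :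
  n.+1%:R * binconv al be x y n.+1 =
  al * x * binconv al be (x - 1) y n + be * y * binconv al be x (y - 1) n.
Proof.
rewrite -binconv_index (binconvC al be x (y - 1)) -binconv_index.
rewrite [X in _ = _ + X](reindex_inj rev_ord_inj) -big_split mulr_sumr.
apply: eq_bigr => j _ /=; have jn : (j <= n.+1)%N by rewrite -ltnS.
rewrite subSS subKn // natrB //; ring.
Qed.

(** Chu-Vandermonde, by induction through the derivative, which lowers the degree. *)
Lemma conv_binpow al x y n : conv (binpow al x) (binpow al y) n = binpow al (x + y) n.
Proof.
elim: n x y => [|n IH] x y; first by rewrite [LHS](binconv0 al al) /binpow gbinom0 mulr1.
apply: (mulfI (natr_neq0 n)); rewrite [LHS]binconv_deriv /binconv !IH.
rewrite [X in _ = _ * X]/binpow [RHS]mulrCA mul_gbinom_diag (_ : x - 1 + y = x + y - 1); last by ring.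
by rewrite addrA exprS /binpow; ring.
Qed.

Lemma conv_binconv al be x y x' y' n :
  conv (binconv al be x y) (binconv al be x' y') n =
  binconv al be (x + x') (y + y') n.
Proof.
have cE u u' v v' k : u =1 u' -> v =1 v' -> conv u v k = conv u' v' k.
  by move=> e1 e2; apply: eq_bigr => j _; rewrite e1 e2.
rewrite /binconv -convA (@cE _ (binpow al x) _ (conv (binpow al x') (conv (binpow be y) (binpow be y')))) //; last first.
  move=> i; rewrite convA [RHS]convA.
  rewrite (@cE _ (conv (binpow al x') (binpow be y)) _ (binpow be y')) //.
  by move=> k; rewrite convC.
by rewrite convA; apply: cE => i; rewrite conv_binpow.
Qed.

End Series.

(** * Determinants given by lists of rows *)

Section DetRows.
Variable K : fieldType.
Implicit Types (s t : seq (nat -> K)).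

Lemma det_rowsE n s : size s = n ->
  det_rows s = \det (\matrix_(i < n, j < n) nth (fun=> 0) s i j).
Proof. by move=> <-. Qed.

Lemma det_rows_map (T : Type) (z : T) (V : T -> nat -> K) (s : seq T) n :
  size s = n -> det_rows (map V s) = \det (\matrix_(i < n, j < n) V (nth z s i) j).
Proof.
move=> sn; rewrite (@det_rowsE n) ?size_map //; congr (\det _).
by apply/matrixP => i j; rewrite !mxE (nth_map z) ?sn.
Qed.

(** The sign is chosen before [V], hence is the same for every [x] on which the rows may depend. *)
Lemma det_rows_perm (T : eqType) (s t : seq T) : perm_eq s t ->
  exists b : bool, forall V : T -> nat -> K,
    det_rows (map V s) = (-1) ^+ b * det_rows (map V t).
Proof.
case: t => [|z t'].
  by move/perm_nilP => ->; exists false => V; rewrite expr0 mul1r.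
set t := z :: t' => /[dup] /perm_size st.
move/(tuple_permP (t := in_tuple t)) => [p sE].
exists (odd_perm p) => V.
rewrite (@det_rows_map _ z V s (size t)) // (@det_rows_map _ z V t (size t)) //.
rewrite -det_perm -det_mulmx -row_permE; congr (\det _).
apply/matrixP => i j; rewrite !mxE; congr (V _ _).
by rewrite sE -tnth_nth tnth_mktuple (tnth_nth z).
Qed.

Lemma det_rows_scale_rows (T : Type) (e : T -> K) (V : T -> nat -> K) (s : seq T) :
  det_rows [seq (fun j => e i * V i j) | i <- s] =
  (\prod_(i <- s) e i) * det_rows (map V s).
Proof.
case: s => [|z s']; first by rewrite big_nil mul1r.
set s := z :: s'.
rewrite !(@det_rows_map _ z _ s (size s)) //.
rewrite (big_nth z) big_mkord.
have -> : \prod_(i < size s) e (nth z s i) =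
   \det (diag_mx (\row_(i < size s) e (nth z s i))).
  by rewrite det_diag; apply: eq_bigr => i _; rewrite mxE.
rewrite -det_mulmx mul_diag_mx; congr (\det _).
by apply/matrixP => i j; rewrite !mxE.
Qed.

Lemma det_rows_scale_cols (u : nat -> K) s :
  det_rows [seq (fun j => u j * f j) | f <- s] =
  (\prod_(j < size s) u j) * det_rows s.
Proof.
rewrite (@det_rows_map _ (fun=> 0) _ s (size s)) // (@det_rowsE (size s)) //.
have -> : \prod_(i < size s) u i = \det (diag_mx (\row_(i < size s) u i)).
  by rewrite det_diag; apply: eq_bigr => i _; rewrite mxE.
rewrite mulrC -det_mulmx mul_mx_diag; congr (\det _).
by apply/matrixP => i j; rewrite !mxE mulrC.
Qed.

(** Reversing the columns makes the matrix lower unitriangular. *)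
Lemma det_antitriangular (n : nat) (h : nat -> K) :
    (forall e, (e < n.-1)%N -> h e = 0) -> ((0 < n)%N -> h n.-1 = 1) ->
  \det (\matrix_(i < n, j < n) h (i + j)%N) =
  (-1) ^+ (perm (@rev_ord_inj n)).
Proof.
move=> h0 h1; set A := \matrix_(_, _) _; set r := perm _.
have : \det (col_perm r A) = 1.
  rewrite det_trig; last first.
    apply/is_trig_mxP => i j ij; rewrite !mxE permE /= h0 //.
    by case: n {h0 h1 A r} i j ij => [[]//|n] i j ij; rewrite subSS /=; case: j ij => j /=; lia.
  rewrite big1 // => i _; rewrite !mxE permE /= -h1 ?(leq_ltn_trans _ (ltn_ord i)) //; congr h.
  by case: n {h0 h1 A r} i => [[]//|n] i; rewrite subSS subnKC // -ltnS.
rewrite col_permE det_mulmx det_perm odd_permV => /(congr1 (fun x => x * (-1) ^+ r)).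
by rewrite -mulrA -expr2 sqrr_sign mulr1 mul1r.
Qed.

(* [V^T X] being lower antitriangular, the first columns of [X] are dual to the
   last columns of [V]: this is Jacobi's identity for complementary minors. *)
Lemma complementary_minors (T : Type) (V X : T -> nat -> K) (h : nat -> K)
    (s t : seq T) (N : nat) : N = (size s + size t)%N ->
    (forall j l, (j < N)%N -> (l < N)%N ->
       \sum_(i <- s ++ t) V i j * X i l = h (j + l)%N) ->
    (forall e, (e < N.-1)%N -> h e = 0) -> h N.-1 = 1 ->
  det_rows (map V (s ++ t)) * det_rows (map X t) =
  (-1) ^+ (perm (@rev_ord_inj (size t))) * det_rows (map V s) /\
  det_rows (map V (s ++ t)) != 0.
Proof.
(* An empty list offers no default value for [nth], hence the separate case. *)
move=> NE; case st : (s ++ t) => [|z st'].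
  have [-> ->] : s = [::] /\ t = [::] by case: (s) st => //; case: (t).
  move=> _ _ _; rewrite /det_rows /= !det_mx00 !mulr1 oner_eq0; split=> //.
  have -> : perm (@rev_ord_inj 0) = 1%g by apply/permP => -[].
  by rewrite odd_perm1.
rewrite -{}st {st'} => VX h0 h1.
set k := size s; set m := size t.
rewrite -/k -/m in NE.
pose W := \matrix_(i < k + m, j < k + m) V (nth z (s ++ t) i) j.
have WE : det_rows (map V (s ++ t)) = \det W.
  by rewrite (@det_rows_map _ z _ _ (k + m)) // size_cat.
have VXn j l : (j < k + m)%N -> (l < k + m)%N ->
    \sum_(i < k + m) V (nth z (s ++ t) i) j * X (nth z (s ++ t) i) l = h (j + l)%N.
  by move=> jN lN; rewrite -VX ?NE // (big_nth z) size_cat big_mkord.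
(* Nonvanishing: the full product V^T X is antitriangular, so its determinant is a sign. *)
split; last first.
  pose Y := \matrix_(i < k + m, j < k + m) X (nth z (s ++ t) i) j.
  have WY : W^T *m Y = \matrix_(i < k + m, j < k + m) h (i + j)%N.
    apply/matrixP => i j; rewrite !mxE -VXn //.
    by apply: eq_bigr => l _; rewrite !mxE.
  have := congr1 determinant WY; rewrite det_mulmx det_tr -WE det_antitriangular -?NE //.
  by move=> E; apply/eqP => W0; move/eqP: E; rewrite W0 mul0r eq_sym signr_eq0.
rewrite WE.
pose G := \matrix_(i < m, j < m) X (nth z t i) j.
pose E := \matrix_(i < k, j < m) X (nth z s i) j.
(* Multiplying [W^T] by this block matrix keeps its first [k] columns and replaces the others by the
   first [m] columns of [h (i + j)], whose upper block [B] vanishes. *)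
have -> : det_rows (map X t) = \det (block_mx 1%:M E 0 G).
  by rewrite det_ublock det1 mul1r (@det_rows_map _ z _ _ m).
have -> : det_rows (map V s) = \det (ulsubmx W)^T.
  rewrite det_tr (@det_rows_map _ z _ _ k) //; congr (\det _).
  by apply/matrixP => i j; rewrite !mxE /= nth_cat ltn_ord.
rewrite -det_tr -det_mulmx -[W in LHS]submxK tr_block_mx mulmx_block !mulmx1 !mulmx0 !addr0.
set B := _ + _ *m G; set D := _ + _ *m G.
have sumE (f : nat -> K) (l : nat) (j : 'I_m) :
  \sum_(i < k + m) V (nth z (s ++ t) i) l * X (nth z (s ++ t) i) j =
  \sum_(i < k) V (nth z (s ++ t) i) l * E i j +
  \sum_(i < m) V (nth z (s ++ t) (k + i)) l * G i j.
  rewrite big_split_ord /=; congr (_ + _); apply: eq_bigr => i _; rewrite !mxE.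
    by rewrite !nth_cat ltn_ord.
  by rewrite !nth_cat ltnNge leq_addr /= addKn.
have -> : B = 0.
  apply/matrixP => i j; rewrite !mxE -[RHS](h0 (i + j)%N); last first.
    by case: i j => i /= ik [j /= jm]; rewrite NE; lia.
  rewrite -VXn ?(leq_trans (ltn_ord i)) ?leq_addr ?(leq_trans (ltn_ord j)) ?leq_addl //.
  by rewrite sumE //; congr (_ + _); apply: eq_bigr => l _; rewrite !mxE.
have -> : D = \matrix_(i < m, j < m) h (k + (i + j))%N.
  apply/matrixP => i j; rewrite [RHS]mxE addnA -VXn ?ltn_add2l ?(leq_trans (ltn_ord j)) ?leq_addl //.
  by rewrite sumE // !mxE; congr (_ + _); apply: eq_bigr => l _; rewrite !mxE.
rewrite det_lblock mulrC; congr (_ * _).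
rewrite (@det_antitriangular m (fun e => h (k + e)%N)) // => [e em|m_gt0].
  by apply: h0; rewrite NE; lia.
by rewrite -h1 NE; congr h; lia.
Qed.
End DetRows.

(** * Determinants of combinations of adjacent columns *)

Section Bidiagonal.

(* The left kernel of the bidiagonal matrix with diagonal [u] and subdiagonal
   [- v]. *)
Definition kappa (D : comNzRingType) (u v : nat -> D) (r l : nat) : D :=
  (\prod_(i < l) u i) * \prod_(l <= i < r) v i.

Lemma kappa_rec (D : comNzRingType) (u v : nat -> D) (r l : nat) : (l < r)%N ->
  u l * kappa u v r l = v l * kappa u v r l.+1.
Proof. by move=> lr; rewrite /kappa big_ord_recr /= [in LHS](big_ltn lr); ring. Qed.

(** By [kappa_rec], the product of the bordered matrix [C] with a bidiagonal [B] has a first row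
    that vanishes outside column 0. Comparing determinants leaves the product of the [v l] on both
    sides, and it cancels since each [v l] is nonzero. *)
Lemma det_bidiagonal_reg (D : idomainType) (r : nat) (u v : nat -> D)
    (f : nat -> nat -> D) :
    (forall l, v l != 0) ->
  \det (\matrix_(i < r, l < r) (u l * f i l - v l * f i l.+1)) =
  (-1) ^+ r * \det (\matrix_(i < r.+1, l < r.+1)
     if nat_of_ord i is i'.+1 then f i' l else kappa u v r l).
Proof.
move=> v0; set C := (X in _ * \det X).
(* Column 0 of [B] copies column 0 of [C]; column [l + 1] combines columns [l] and [l + 1] of
   [C]. *)
pose B := \matrix_(i < r.+1, l < r.+1)
  if nat_of_ord l is l'.+1 then u l' *+ (i == l' :> nat) - v l' *+ (i == l :> nat)
  else (i == l)%:R.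
have detB : \det B = \prod_(l < r) (- v l).
  rewrite -det_tr det_trig; last first.
    apply/is_trig_mxP => i j ij; rewrite !mxE.
    case: i ij => -[|i] /= ir ij; first by rewrite -val_eqE /= gtn_eqF.
    by rewrite !gtn_eqF ?subrr //; lia.
  rewrite big_ord_recl !mxE eqxx mul1r; apply: eq_bigr => l _.
  by rewrite !mxE !lift0 eqxx gtn_eqF // mulr0n sub0r.
have CB i (l : 'I_r) : (C *m B) i (lift ord0 l) =
    u l * C i (widen_ord (leqnSn r) l) - v l * C i (lift ord0 l).
  rewrite !mxE; under eq_bigr => k _ do rewrite [B _ _]mxE lift0 mulrBr.
  rewrite sumrB; congr (_ - _).
    rewrite (bigD1 (widen_ord (leqnSn r) l)) //= eqxx big1 ?addr0 ?mxE 1?mulrC // => k.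
    by rewrite -val_eqE /= => /negPf ->; rewrite mulr0.
  rewrite (bigD1 (lift ord0 l)) // lift0 eqxx big1 => [|k].
    by rewrite mxE lift0 /= addr0 mulrC.
  by rewrite -val_eqE /= /bump /= add1n => /negPf ->; rewrite mulr0.
have CB0 i : (C *m B) i ord0 = C i ord0.
  rewrite !mxE (bigD1 ord0) //= !mxE eqxx mulr1 big1 ?addr0 // => k /negPf k0.
  by rewrite [B _ _]mxE k0 mulr0.
have := det_mulmx C B; rewrite (expand_det_row _ ord0) big_ord_recl.
rewrite [X in _ + X]big1 => [|l _]; last first.
  by rewrite CB !mxE lift0 /= kappa_rec // subrr mul0r.
move=> E; have {E} : (C *m B) ord0 ord0 * cofactor (C *m B) ord0 ord0 = \det C * \det B.
  by rewrite -E; apply/esym/addr0.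
rewrite CB0 /cofactor addn0 expr0 mul1r detB prodrN cardT size_enum_ord.
rewrite [C _ _]mxE /kappa big_ord0 mul1r big_mkord.
set M := row' _ _; have -> : M = \matrix_(i < r, l < r) (u l * f i l - v l * f i l.+1).
  by apply/matrixP => i l; rewrite [RHS]mxE [M i l]mxE mxE CB !mxE !lift0.
have P0 : \prod_(l < r) v l != 0 by apply/prodf_neq0 => l _.
by rewrite mulrCA mulrA [_ * \det C]mulrC -mulrA => E; apply: (mulfI P0); rewrite E; ring.
Qed.

(* The entries [v l + X] over polynomials are regular; specialise at [X = 0]. *)
Lemma det_bidiagonal (D : idomainType) (r : nat) (u v : nat -> D)
    (f : nat -> nat -> D) :
  \det (\matrix_(i < r, l < r) (u l * f i l - v l * f i l.+1)) =
  (-1) ^+ r * \det (\matrix_(i < r.+1, l < r.+1)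
     if nat_of_ord i is i'.+1 then f i' l else kappa u v r l).
Proof.
pose P := @polyC D.
have v0 l : (v l)%:P + 'X != 0 :> {poly D}.
  by rewrite -size_poly_eq0 addrC size_XaddC.
have := @det_bidiagonal_reg _ r (fun l => (u l)%:P) (fun l => (v l)%:P + 'X)
  (fun i l => (f i l)%:P) v0.
move/(congr1 (horner_eval 0)); rewrite rmorphM rmorphXn rmorphN1 -!det_map_mx.
have ev0 (q : {poly D}) : (horner_eval 0 : {rmorphism {poly D} -> D}) q = q.[0].
  by [].
move=> H; apply: etrans (etrans (congr1 determinant _) H)
  (congr1 ( *%R ((-1) ^+ r)) (congr1 determinant _));
  apply/matrixP => i l; rewrite !mxE ev0.
  by rewrite !hornerE.
case: i => -[|i] /= _; last by rewrite hornerC.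
rewrite /kappa hornerM !horner_prod.
by congr (_ * _); apply: eq_bigr => k _; rewrite !hornerE.
Qed.

End Bidiagonal.

(** * Forward differences in the column index *)

Section Difference.
Variable K : fieldType.
Implicit Types (s : seq (nat -> K)) (f : nat -> K).

Lemma det_rows_bidiagonal (u v : nat -> K) s :
  det_rows [seq (fun l => u l * f l - v l * f l.+1) | f <- s] =
  (-1) ^+ size s * det_rows (kappa u v (size s) :: s).
Proof.
rewrite (@det_rows_map _ _ (fun=> 0) _ s (size s)) //.
rewrite (det_bidiagonal _ u v (fun i => nth (fun=> 0) s i)).
congr (_ * _); congr (\det _); apply/matrixP => i j; rewrite !mxE.
by case: i => -[].
Qed.

Definition delta f : nat -> K := fun j => f j.+1 - f j.

(** For [u = v = 1] the kernel row [kappa] is constant; the sign is absorbed by turning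
    [f l - f l.+1] into [delta f l]. *)
Lemma det_rows_ones s : det_rows ((fun=> 1) :: s) = det_rows (map delta s).
Proof.
have /esym := det_rows_bidiagonal (fun=> 1) (fun=> 1) s.
have -> : kappa (fun=> 1) (fun=> 1) (size s) = fun=> 1 :> K.
  by apply: boolp.funext => l; rewrite /kappa !big1 ?mulr1.
have -> : [seq (fun l => 1 * f l - 1 * f l.+1) | f <- s] =
          [seq (fun l => -1 * delta f l) | f <- s].
  by apply: eq_map => f; apply: boolp.funext => l; rewrite /delta; ring.
rewrite (det_rows_scale_rows (fun=> -1) delta) big_const_seq count_predT iter_mulr_1.
by move/mulfI; apply; rewrite signr_eq0.
Qed.

Lemma iter_deltaE p f j :
  iter p delta f j = \sum_(k < p.+1) (-1) ^+ (p - k) * 'C(p, k)%:R * f (j + k)%N.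
Proof.
elim: p j => [|p IH] j; first by rewrite big_ord1 addn0 bin0 !mul1r.
rewrite iterS {1}/delta !IH [RHS]big_ord_recl.
have -> : \sum_(k < p.+1) (-1) ^+ (p.+1 - lift ord0 k) * 'C(p.+1, lift ord0 k)%:R * f (j + lift ord0 k)%N =
  \sum_(k < p.+1) (-1) ^+ (p - k) * 'C(p, k.+1)%:R * f (j + k.+1)%N +
  \sum_(k < p.+1) (-1) ^+ (p - k) * 'C(p, k)%:R * f (j.+1 + k)%N.
  rewrite -big_split; apply: eq_bigr => k _ /=.
  by rewrite /bump /= add1n binS natrD subSS addSnnS mulrDr mulrDl.
rewrite [RHS]addrA [RHS]addrC; congr (_ + _).
rewrite [in RHS]big_ord_recr /= (bin_small (ltnSn p)) mulr0 mul0r addr0 big_ord_recl opprD.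
rewrite !bin0 !addn0 !subn0 !mulr1 exprS; congr (_ + _); first ring.
rewrite -sumrN; apply: eq_bigr => k _.
rewrite lift0 -[in RHS](subnSK (ltn_ord k)) exprS; ring.
Qed.

End Difference.

(** * Meixner polynomials *)

Section Meixner.
Variable K : numFieldType.
Implicit Types (c d x y : K) (n : nat).

Lemma gbinom_nat (n j : nat) : gbinom (n%:R : K) j = 'C(n, j)%:R.
Proof.
elim: n j => [|n IH] [|j]; rewrite ?gbinom0 ?bin0 //.
  by rewrite /gbinom big_ord_recl subrr mul0r mul0r.
by rewrite -natr1 gbinom_pascal !IH binS natrD.
Qed.

Section Relations.
Variable a : K.
Hypotheses (a0 : a != 0) (a1 : a != 1).

Lemma subr1_neq0 : 1 - a != 0. Proof. by rewrite subr_eq0 eq_sym. Qed.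

(** Splitting the prefactor between the two binomials gives al = 1/(1-a) and be = a/(1-a) in the
    generating function. *)
Lemma meixnerE c n x :
  meixner a c n x = binconv (1 - a)^-1 (a / (1 - a)) x (- x - c) n.
Proof.
rewrite /meixner /binconv /conv mulr_sumr; apply: eq_bigr => j _.
have jn : (j <= n)%N by rewrite -ltnS.
have pE (z : K) : z ^+ n = z ^+ j * z ^+ (n - j) by rewrite -exprD subnKC.
rewrite /binpow expr_div_n exprVn !pE.
by field; rewrite !expf_neq0 ?subr1_neq0.
Qed.

Lemma meixner0 c x : meixner a c 0 x = 1.
Proof. by rewrite meixnerE binconv0. Qed.

Lemma meixner_at0 c n : meixner a c n 0 = (a / (1 - a)) ^+ n * gbinom (- c) n.
Proof.
rewrite meixnerE oppr0 add0r /binconv /conv big_ord_recl big1 => [|j _].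
  by rewrite addr0 {1}/binpow gbinom0 !mul1r subn0.
by rewrite {1}/binpow (gbinom_nat 0) lift0 /= mulr0 mul0r.
Qed.

(** Here (1 + al z) - (1 + be z) = z, because al - be = 1. *)
Lemma meixner_delta d n y :
  meixner a d n.+1 (y + 1) - meixner a d n.+1 y = meixner a (d + 1) n y.
Proof.
rewrite !meixnerE (_ : - (y + 1) - d = - y - (d + 1)); last by ring.
rewrite binconv_pascall (_ : - y - d = - y - (d + 1) + 1); last by ring.
by rewrite binconv_pascalr; field; exact: subr1_neq0.
Qed.

(** Here a (1 + al z) - (1 + be z) = a - 1, so the degree stays. *)
Lemma meixner_twisted_delta d n y :
  a * meixner a d n (y + 1) - meixner a d n y = (a - 1) * meixner a (d + 1) n y.
Proof.
case: n => [|n]; first by rewrite !meixner0; ring.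
rewrite !meixnerE (_ : - (y + 1) - d = - y - (d + 1)); last by ring.
rewrite binconv_pascall (_ : - y - d = - y - (d + 1) + 1); last by ring.
by rewrite binconv_pascalr; field; exact: subr1_neq0.
Qed.

Lemma meixner_conv c d n x y :
  \sum_(i < n.+1) meixner a c i x * meixner a d (n - i) y =
  meixner a (c + d) n (x + y).
Proof.
rewrite meixnerE (_ : - (x + y) - (c + d) = - x - c + (- y - d)); last by ring.
by rewrite -conv_binconv; apply: eq_bigr => i _; rewrite !meixnerE.
Qed.

Lemma meixner_deriv d n y :
  n.+1%:R * meixner a d n.+1 y =
  (1 - a)^-1 * (y * meixner a (d + 1) n (y - 1) - a * (y + d) * meixner a (d + 1) n y).
Proof.
rewrite !meixnerE binconv_deriv (_ : - (y - 1) - (d + 1) = - y - d); last by ring.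
rewrite (_ : - y - (d + 1) = - y - d - 1); last by ring.
by field; exact: subr1_neq0.
Qed.

(** Let A = 1 + al z, B = 1 + be z, Y = -y - d. In (d + z d/dz) A^y B^Y replace al z by A - 1 and be
    z by B - 1; the terms in A^y B^Y cancel since d + y + Y = 0. *)
Lemma meixner_euler d n y :
  (d + n%:R) * meixner a d n y =
  (y + d) * meixner a (d + 1) n y - y * meixner a (d + 1) n (y - 1).
Proof.
case: n => [|n]; first by rewrite !meixner0 addr0; ring.
have := meixner_deriv d n y.
rewrite !meixnerE (_ : - (y - 1) - (d + 1) = - y - d); last by ring.
rewrite (_ : - y - (d + 1) = - y - d - 1); last by ring.
set X := _ - 1; set Y := - y - d; set al := (1 - a)^-1; set be := a / (1 - a).
move=> D.
have EX : binconv al be y Y n.+1 = binconv al be X Y n.+1 + al * binconv al be X Y n.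
  by rewrite -binconv_pascall /X subrK.
have EY : binconv al be y Y n.+1 =
    binconv al be y (Y - 1) n.+1 + be * binconv al be y (Y - 1) n.
  by rewrite -binconv_pascalr subrK.
rewrite mulrDl {}D [X in X + _](_ : _ = - y * binconv al be y Y n.+1 - Y * binconv al be y Y n.+1); last by rewrite /Y; ring.
rewrite {1}EX {1}EY /Y /al /be; field; exact: subr1_neq0.
Qed.

End Relations.
End Meixner.

(** * The residue pairing *)

Section Duality.
Variables (K : numFieldType) (a : K).
Hypotheses (a0 : a != 0) (a1 : a != 1).

Let a1' : 1 - a != 0. Proof. exact: subr1_neq0. Qed.
Let va0 : a^-1 != 0. Proof. by rewrite invr_eq0. Qed.
Let va1 : a^-1 != 1. Proof. by rewrite invr_eq1. Qed.

(** Weights of the residues at q = 1 and q = 1/a, scaled so that the first nonzero value of [hank]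
    is 1. *)
Definition wt1 (s2 : nat) : K := (- (a / (1 - a))) ^+ s2.
Definition wt2 (s1 s2 : nat) : K := (1 - a)^-1 ^+ s1 * a ^+ (s1 + s2).-1.

(* Up to a constant factor, the sum of the residues at [q = 1] and [q = 1/a] of
   [q^e / ((q - 1)^s1 (q - 1/a)^s2)]. *)
Definition hank (s1 s2 e : nat) : K :=
  (if s1 is n.+1 then wt1 s2 * meixner a (2 - (s1 + s2)%:R) n e%:R else 0) +
  (if s2 is n.+1 then
     wt2 s1 s2 / a ^+ e * meixner a^-1 (2 - (s1 + s2)%:R) n e%:R else 0).

(** Write the extra factor q as 1 + (q - 1). *)
Lemma hank_recl (s1 s2 e : nat) : (0 < s1 + s2)%N ->
  hank s1.+1 s2 e.+1 = hank s1.+1 s2 e + hank s1 s2 e.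
Proof.
move=> s_gt0; rewrite /hank addSn.
have dE : 2 - (s1 + s2)%:R = 2 - (s1 + s2).+1%:R + 1 :> K by rewrite -natr1; ring.
rewrite dE -(natr1 e); set d := 2 - _.
set A1 := wt1 s2 * _; set A2 := wt1 s2 * _; set A3 := if s1 is _.+1 then _ else _.
set B1 := if s2 is _.+1 then _ else _; set B2 := if s2 is _.+1 then _ else _.
set B3 := if s2 is _.+1 then _ else _.
have -> : A1 = A2 + A3.
  rewrite /A1 /A2 /A3; case: (s1) => [|n]; first by rewrite !meixner0 // addr0.
  by rewrite -meixner_delta //; ring.
suff -> : B1 = B2 + B3 by ring.
rewrite /B1 /B2 /B3; case: (s2) s_gt0 => [|n] s_gt0; first by rewrite addr0.
apply/eqP; rewrite -subr_eq0.
have D := meixner_twisted_delta va0 va1 d n e%:R.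
have {}D : meixner a^-1 d n (e%:R + 1) = a * (meixner a^-1 d n e%:R + (a^-1 - 1) * meixner a^-1 (d + 1) n e%:R).
  by rewrite -D; field.
rewrite D /wt2 addSn addnS /= !exprS; apply/eqP; field.
by rewrite !expf_neq0 ?a0 ?a1'.
Qed.

(** Write the extra factor q as 1/a + (q - 1/a). *)
Lemma hank_recr (s1 s2 e : nat) : (0 < s1 + s2)%N ->
  hank s1 s2.+1 e.+1 = a^-1 * hank s1 s2.+1 e + hank s1 s2 e.
Proof.
move=> s_gt0; rewrite /hank addnS.
have dE : 2 - (s1 + s2)%:R = 2 - (s1 + s2).+1%:R + 1 :> K by rewrite -natr1; ring.
rewrite dE -(natr1 e); set d := 2 - _.
set A1 := if s1 is _.+1 then _ else _; set A2 := if s1 is _.+1 then _ else _.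
set A3 := if s1 is _.+1 then _ else _.
set B1 := wt2 _ _ / _ * _; set B2 := wt2 _ _ / _ * _.
set B3 := if s2 is _.+1 then _ else _.
have -> : A1 = a^-1 * A2 + A3.
  rewrite /A1 /A2 /A3; case: (s1) => [|n]; first by rewrite mulr0 addr0.
  have D := meixner_twisted_delta a0 a1 d n e%:R.
  have {}D : meixner a d n (e%:R + 1) = a^-1 * (meixner a d n e%:R + (a - 1) * meixner a (d + 1) n e%:R).
    by rewrite -D; field.
  rewrite D /wt1 !exprS; field.
  by rewrite ?expf_neq0 ?a0 ?a1'.
suff -> : B1 = a^-1 * B2 + B3 by ring.
rewrite /B1 /B2 /B3 /wt2 addnS /=; case: (s2) s_gt0 => [|n] s_gt0.
  rewrite !meixner0 // !addn0 exprS; field.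
  by rewrite !expf_neq0 ?a0 ?a1'.
have D := meixner_delta va0 va1 d n e%:R.
have {}D : meixner a^-1 d n.+1 (e%:R + 1) = meixner a^-1 d n.+1 e%:R + meixner a^-1 (d + 1) n e%:R.
  by rewrite -D; ring.
rewrite D !addnS /= !exprS; field.
by rewrite !expf_neq0 ?a0 ?a1'.
Qed.

(** A denominator of degree at least 2 leaves no residue at infinity. With two poles, the equal
    binomials C(m+n, m) and C(m+n, n) occur with opposite factors; with one pole, the binomial is
    zero. *)
Lemma hank_at0 (s1 s2 : nat) : (1 < s1 + s2)%N -> hank s1 s2 0 = 0.
Proof.
move=> s_gt1; rewrite /hank.
have dE n : (s1 + s2 = n.+2)%N -> - (2 - (s1 + s2)%:R) = n%:R :> K.
  by move=> ->; rewrite -2!natr1; ring.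
case: s1 s_gt1 dE => [|m] s_gt1 dE.
  rewrite add0r; case: s2 s_gt1 dE => [|[|n]] // _ dE.
  by rewrite meixner_at0 // (dE n) // gbinom_nat bin_small ?mulr0.
case: s2 s_gt1 dE => [|n] s_gt1 dE.
  rewrite addn0 in s_gt1 dE *; case: m s_gt1 dE => [|m] // _ dE.
  by rewrite meixner_at0 // (dE m) // gbinom_nat bin_small ?mulr0 ?addr0.
have {}dE : - (2 - (m.+1 + n.+1)%:R) = (m + n)%:R :> K by apply: dE; rewrite addSn addnS.
rewrite !meixner_at0 // dE !gbinom_nat -(bin_sub (leq_addl m n)) addnK.
have -> : a^-1 / (1 - a^-1) = - (1 - a)^-1.
  by field; rewrite a0 a1' -[_ - 1]opprB oppr_eq0.
rewrite /wt1 /wt2 addSn addnS /= expr0 divr1 !exprS exprD (exprNn (a / _)) (exprNn (1 - a)^-1)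
  !expr_div_n !exprVn.
by field; rewrite !expf_neq0 ?a0 ?a1'.
Qed.

(** By induction on [s1 + s2], then on [e]; the top value 1 is inherited from a single simple
    pole. *)
Lemma hankE (s1 s2 e : nat) : (0 < s1 + s2)%N -> (e <= (s1 + s2).-1)%N ->
  hank s1 s2 e = (e == (s1 + s2).-1)%:R.
Proof.
move sE: (s1 + s2)%N => [//|N] _ /=; elim: N s1 s2 e sE => [|N IH] s1 s2 e sE.
  rewrite leqn0 => /eqP ->; rewrite eqxx.
  case: s1 s2 sE => [|[|s1]] [|[|s2]] // _; rewrite /hank /wt1 /wt2 ?meixner0 //=.
    by rewrite add0r !expr0 divr1 !mulr1.
  by rewrite addr0 !expr0 !mulr1.
elim: e => [_|e IHe eN]; first by rewrite hank_at0 ?sE.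
case: s1 sE IHe => [|s1] sE IHe.
  case: s2 sE IHe => // s2 sE IHe.
  rewrite hank_recr; last by case: sE => ->.
  rewrite IHe ?(ltnW eN) // ltn_eqF // mulr0 add0r IH //.
  by case: sE.
rewrite hank_recl; last by case: sE => ->.
rewrite IHe ?(ltnW eN) // ltn_eqF // add0r IH //.
by case: sE.
Qed.

Variable c : K.

(* [inl f] and [inr f] index the two families of seeds. *)
Definition seedrow (x : K) (i : nat + nat) (j : nat) : K :=
  match i with
  | inl f => meixner a c f (x + j%:R)
  | inr f => meixner a^-1 c f (x + j%:R) / a ^+ j
  end.

(** Index reversed within its family, [x] reflected, and a parameter that adds up with [c] to the
    parameter [2 - (s1 + s2)] of [hank]. *)
Definition dualrow (s1 s2 : nat) (x : K) (i : nat + nat) (l : nat) : K :=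
  match i with
  | inl f => wt1 s2 * meixner a (2 - c - (s1 + s2)%:R) (s1.-1 - f) (- x + l%:R)
  | inr f => wt2 s1 s2 / a ^+ l *
             meixner a^-1 (2 - c - (s1 + s2)%:R) (s2.-1 - f) (- x + l%:R)
  end.

Definition allseeds (s1 s2 : nat) : seq (nat + nat) :=
  map inl (iota 0 s1) ++ map inr (iota 0 s2).

Lemma size_allseeds s1 s2 : size (allseeds s1 s2) = (s1 + s2)%N.
Proof. by rewrite size_cat !size_map !size_iota. Qed.

(** By [meixner_conv], [x] cancels against [- x] and each family sums to one residue. *)
Lemma pairing_seeds (s1 s2 : nat) (x : K) (j l : nat) :
  \sum_(i <- allseeds s1 s2) seedrow x i j * dualrow s1 s2 x i l =
  hank s1 s2 (j + l).
Proof.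
rewrite big_cat !big_map /= /hank.
have xE : x + j%:R + (- x + l%:R) = (j + l)%:R by rewrite natrD; ring.
have dE : 2 - (s1 + s2)%:R = c + (2 - c - (s1 + s2)%:R) by ring.
rewrite -xE dE; set d := 2 - c - _.
congr (_ + _).
  case: (s1) => [|n]; first by rewrite big_nil.
  rewrite -meixner_conv // mulr_sumr -[X in iota _ X]subn0 -/(index_iota 0 n.+1) big_mkord.
  by apply: eq_bigr => i _; ring.
rewrite /wt2; case: (s2) => [|n]; first by rewrite big_nil.
rewrite -meixner_conv // mulr_sumr -[X in iota _ X]subn0 -/(index_iota 0 n.+1) big_mkord.
by apply: eq_bigr => i _; rewrite exprD; field; rewrite !expf_neq0 ?a0 ?a1'.
Qed.

(* Translating [x] multiplies the matrix of seeds by a unitriangular one. *)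
Lemma det_allseeds_const (s1 s2 : nat) (x : K) :
  det_rows (map (seedrow x) (allseeds s1 s2)) =
  det_rows (map (seedrow 0) (allseeds s1 s2)).
Proof.
set s := allseeds s1 s2; set N := size s.
(* By [meixner_conv] with parameters [c] and 0, a seed at [x + j] expands over seeds of its own
   family with index at most its own; equal indices give coefficient 1. *)
pose L (i k : nat + nat) : K := match i, k with
  | inl f, inl g => if (g <= f)%N then meixner a 0 (f - g) x else 0
  | inr f, inr g => if (g <= f)%N then meixner a^-1 0 (f - g) x else 0
  | _, _ => 0 end.
have nthE i : (i < N)%N -> nth (inl 0) s i = if (i < s1)%N then inl i else inr (i - s1)%N.
  rewrite /N size_allseeds => iN; rewrite nth_cat size_map size_iota.
  case: ltnP => i1; first by rewrite (nth_map 0%N) ?size_iota // nth_iota.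
  by rewrite (nth_map 0%N) ?size_iota ?nth_iota //; lia.
have LE i j : i \in s -> seedrow x i j = \sum_(k <- s) L i k * seedrow 0 k j.
  have cut (b : K) n f : b != 0 -> b != 1 -> (f < n)%N ->
      \sum_(k <- iota 0 n) (if (k <= f)%N then meixner b 0 (f - k) x else 0) * meixner b c k (0 + j%:R) =
      meixner b c f (x + j%:R).
    move=> b0 b1 fn; rewrite add0r addrC -[in RHS](addr0 c) -meixner_conv //.
    rewrite -[X in iota _ X]subn0 -/(index_iota 0 n) big_mkord.
    rewrite [RHS](big_ord_widen n (fun i => meixner b c i j%:R * meixner b 0 (f - i) x)) //.
    rewrite [RHS]big_mkcond; apply: eq_bigr => k _ /=.
    by rewrite ltnS; case: leqP => _; rewrite ?mul0r // mulrC.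
  rewrite mem_cat => /orP[] /mapP[f]; rewrite mem_iota add0n => /andP[_ fs] ->;
    rewrite big_cat !big_map /=.
    rewrite [X in _ = _ + X]big1 => [|k _]; last by rewrite mul0r.
    by rewrite cut // addr0.
  rewrite [X in _ = X + _]big1 => [|k _]; last by rewrite mul0r.
  rewrite [RHS]add0r -(cut _ s2) // mulr_suml; apply: eq_bigr => k _ /=.
  by rewrite -mulrA.
rewrite !(@det_rows_map _ _ (inl 0%N) _ s N) //.
have -> : \matrix_(i < N, j < N) seedrow x (nth (inl 0%N) s i) j =
   (\matrix_(i < N, k < N) L (nth (inl 0%N) s i) (nth (inl 0%N) s k)) *m
   (\matrix_(k < N, j < N) seedrow 0 (nth (inl 0%N) s k) j).
  apply/matrixP => i j; rewrite !mxE LE ?mem_nth //.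
  rewrite (big_nth (inl 0%N)) big_mkord; apply: eq_bigr => k _.
  by rewrite !mxE.
rewrite det_mulmx det_trig; last first.
  apply/is_trig_mxP => i j ij; rewrite !mxE !nthE //.
  case: (ltnP i s1) => i1; case: (ltnP j s1) => j1 //=; case: leqP => //; lia.
rewrite big1 ?mul1r // => i _; rewrite !mxE !nthE //.
by case: (ltnP i s1) => i1 /=; rewrite leqnn subnn meixner0.
Qed.

End Duality.

(** * Lowering the seeds *)

Section Reduction.
Variables (K : numFieldType) (a : K).
Hypotheses (a0 : a != 0) (a1 : a != 1).

Let a1' : 1 - a != 0. Proof. exact: subr1_neq0. Qed.
Let va0 : a^-1 != 0. Proof. by rewrite invr_eq0. Qed.
Let va1 : a^-1 != 1. Proof. by rewrite invr_eq1. Qed.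

Definition seedpred (i : nat + nat) : nat + nat :=
  if i is inl f then inl f.-1 else i.

Definition seedwt (d : K) (i : nat + nat) : K :=
  match i with inl f => f%:R * (1 - a) | inr f => - (d + f%:R) end.

(** The first family uses [meixner_deriv], the second [meixner_euler]. Both give the same
    coefficients, so one bidiagonal matrix serves all rows. *)
Lemma seedrow_bidiagonal (d y : K) (i : nat + nat) (l : nat) : i != inl 0%N ->
  seedwt d i * seedrow a d y i l =
  (y + l%:R) * seedrow a (d + 1) (y - 1) (seedpred i) l -
  a * (y + l%:R + d) * seedrow a (d + 1) (y - 1) (seedpred i) l.+1.
Proof.
have E1 : y - 1 + l%:R = y + l%:R - 1 by ring.
have E2 : y - 1 + l.+1%:R = y + l%:R by rewrite -natr1; ring.
case: i => [[|f]|f] //= _; rewrite E1 E2.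
  by rewrite mulrAC meixner_deriv //; field.
rewrite exprS mulrA mulNr meixner_euler //; field.
by rewrite expf_neq0 ?a0.
Qed.

Lemma delta_seedrow_inl d y f :
  delta (seedrow a d y (inl f.+1)) = seedrow a (d + 1) y (inl f).
Proof.
by apply: boolp.funext => l; rewrite /delta /= -natr1 addrA meixner_delta.
Qed.

Lemma delta_seedrow_inr d y f :
  delta (seedrow a d y (inr f)) =
  fun l => (a^-1 - 1) * seedrow a (d + 1) y (inr f) l.
Proof.
apply: boolp.funext => l; rewrite /delta /= mulrA -meixner_twisted_delta //.
by rewrite -natr1 addrA exprS; field; rewrite expf_neq0 ?a0.
Qed.

Lemma iter_delta_seedrow_inl d y f p :
  iter p (@delta K) (seedrow a d y (inl (p + f)%N)) =
  seedrow a (d + p%:R) y (inl f).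
Proof.
elim: p d => [|p IH] d; first by rewrite addr0.
by rewrite iterSr addSn delta_seedrow_inl IH -natr1 -addrA (addrC 1).
Qed.

Lemma iter_delta_seedrow_inr d y f p :
  iter p (@delta K) (seedrow a d y (inr f)) =
  fun l => (a^-1 - 1) ^+ p * seedrow a (d + p%:R) y (inr f) l.
Proof.
elim: p => [|p IH]; first by apply: boolp.funext => l; rewrite addr0 mul1r.
rewrite iterS {}IH; apply: boolp.funext => l.
have := congr1 (fun g => g l) (delta_seedrow_inr (d + p%:R) y f).
by rewrite -natr1 addrA exprSr -mulrA => <-; rewrite /delta mulrBr.
Qed.

(** The seed of index 0 is a row of ones; removing it takes differences of the other rows, which
    brings the next seed to index 0. *)
Lemma det_rows_seed_prefix d y p s :
  det_rows ([seq seedrow a d y (inl i) | i <- iota 0 p] ++ s) =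
  det_rows (map (iter p (@delta K)) s).
Proof.
elim: p d s => [|p IH] d s; first by rewrite map_id.
rewrite /= (_ : seedrow a d y (inl 0%N) = fun=> 1); last first.
  by apply: boolp.funext => l; rewrite /= meixner0.
rewrite det_rows_ones map_cat (iotaDl 1 0) -!map_comp.
rewrite (eq_map (g := fun i => seedrow a (d + 1) y (inl i))); last first.
  by move=> i; apply: delta_seedrow_inl.
by rewrite IH -map_comp; congr det_rows; apply: eq_map => f; rewrite /= -iterSr.
Qed.

(* The discrete Rodrigues formula for the weight [kappa]. *)
Lemma iter_delta_kappa (ct x : K) (p m j : nat) : (j <= m)%N ->
  iter p (@delta K) (kappa (fun l => - x + l%:R)
      (fun l => a * (- x + l%:R + (1 - ct - p%:R))) (p + m)) j =
  (-1) ^+ (p + m) * (p`!)%:R * (1 - a) ^+ p * a ^+ m * a ^- j *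
  (rfac ct m j x * meixner a ct p (x - j%:R)).
Proof.
(* The expansion of the [p]-th difference matches the sum defining [meixner] term by term. *)
move=> jm; rewrite iter_deltaE /meixner !mulr_sumr; apply: eq_bigr => k _.
have kp : (k <= p)%N by rewrite -ltnS.
set A := \prod_(i < j) (x - i%:R).
have pochE1 : poch (x - j%:R + 1) j = A.
  rewrite /poch (reindex_inj rev_ord_inj); apply: eq_bigr => i _ /=.
  by rewrite natrB // -natr1; ring.
have gbE1 : \prod_(i < k) (x - j%:R - i%:R) = (k`!)%:R * gbinom (x - j%:R) k.
  by rewrite /gbinom mulrCA divff ?mulr1 ?factr_neq0.
(* The first [j] factors form the second Pochhammer factor of [rfac], the next [k] the first
   binomial. *)
have uE : \prod_(i < j + k) (- x + i%:R) = (-1) ^+ (j + k) * (A * ((k`!)%:R * gbinom (x - j%:R) k)).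
  rewrite -gbE1 /A; under eq_bigr => i _ do rewrite addrC -opprB.
  rewrite prodrN cardT size_enum_ord big_split_ord /=; congr (_ * (_ * _)).
  by apply: eq_bigr => i _; rewrite natrD; ring.
(* The product of the [v i] is cut at [j + p]: the lower part is the second binomial, the upper part
   the first Pochhammer factor of [rfac]. *)
have vE1 : \prod_(j + k <= i < j + p) (a * (- x + i%:R + (1 - ct - p%:R))) =
   a ^+ (p - k) * (((p - k)`!)%:R * gbinom (- (x - j%:R) - ct) (p - k)).
  rewrite -[(j + k)%N in LHS]add0n big_addn subnDl big_mkord big_split prodr_const card_ord /=.
  congr (_ * _); rewrite /gbinom mulrCA divff ?mulr1 ?factr_neq0 //.
  rewrite (reindex_inj rev_ord_inj); apply: eq_bigr => i _ /=.
  by rewrite natrD natrD natrB // -natr1 natrB //; ring.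
have vE2 : \prod_(j + p <= i < p + m) (a * (- x + i%:R + (1 - ct - p%:R))) =
   a ^+ (m - j) * ((-1) ^+ (m - j) * poch (ct + x - m%:R) (m - j)).
  rewrite -[(j + p)%N in LHS]add0n big_addn (_ : p + m - (j + p) = m - j)%N; last by lia.
  rewrite big_mkord big_split prodr_const card_ord /=; congr (_ * _).
  rewrite (reindex_inj rev_ord_inj) /poch.
  transitivity (\prod_(i < m - j) - (ct + x - m%:R + i%:R)); last first.
    by rewrite prodrN cardT size_enum_ord.
  apply: eq_bigr => i _ /=.
  by rewrite natrD natrD natrB // -natr1 natrB //; ring.
rewrite /kappa uE (big_cat_nat (n := (j + p)%N)) /=; [|lia|lia].
rewrite vE1 vE2 /rfac pochE1.
have facE : 'C(p, k)%:R * (k`!)%:R * ((p - k)`!)%:R = (p`!)%:R :> K.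
  by rewrite -!natrM -mulnA bin_fact.
rewrite -facE.
have pE (z : K) : z ^+ p = z ^+ k * z ^+ (p - k) by rewrite -exprD subnKC.
have mE (z : K) : z ^+ m = z ^+ j * z ^+ (m - j) by rewrite -exprD subnKC.
rewrite !exprD (pE (-1)) (mE (-1)) (pE a) (mE a).
rewrite (pE (1 - a)).
field.
by rewrite !expf_neq0 ?a0 ?a1'.
Qed.

End Reduction.

(** The bound on [j] is what permits the use of [iter_delta_kappa], valid for [j <= m] only. *)
Lemma eq_det_rows (K : fieldType) (T : eqType) (V W : T -> nat -> K) (s : seq T) :
  (forall i j, i \in s -> (j < size s)%N -> V i j = W i j) ->
  det_rows (map V s) = det_rows (map W s).
Proof.
case: s => [|z s'] // VW; rewrite !(@det_rows_map _ _ z _ _ (size (z :: s'))) //.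
by congr (\det _); apply/matrixP => i j; rewrite !mxE VW ?mem_nth.
Qed.

(** * From dual seeds to the rows of [detR] *)

Section DualReduction.
Variables (K : numFieldType) (a : K).
Hypotheses (a0 : a != 0) (a1 : a != 1).

Let a1' : 1 - a != 0. Proof. exact: subr1_neq0. Qed.

(** [None] marks the additional row that comes from the left kernel. *)
Definition Rrow (ct : K) (m p : nat) (x : K) (i : option (nat + nat)) (j : nat) : K :=
  match i with
  | None => rfac ct m j x * meixner a ct p (x - j%:R)
  | Some (inl g) => a ^+ j * meixner a (2 - ct) g (- x - 1 + j%:R)
  | Some (inr g) => meixner a^-1 (2 - ct) g (- x - 1 + j%:R)
  end.

Definition Rindex (G1 G2 : seq nat) : seq (option (nat + nat)) :=
  None :: map Some (map inl G1 ++ map inr G2).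

(** The hypothesis on [G2] keeps the factors [seedwt] of the second family nonzero; those of the
    first are nonzero as all its indices are positive. *)
Lemma det_dual_reduction (ct : K) (p : nat) (G1 G2 : seq nat) :
    (forall g, g \in G2 -> 1 - ct - p%:R + g%:R != 0) ->
  exists2 beta : K, beta != 0 & forall x,
    det_rows (map (seedrow a (1 - ct - p%:R) (- x))
      (map inl (iota 1 p ++ [seq (p.+1 + g)%N | g <- G1]) ++ map inr G2)) =
    beta * det_rows (map (Rrow ct (size G1 + size G2) p x) (Rindex G1 G2)).
Proof.
move=> G2_neq0; set d := 1 - ct - p%:R in G2_neq0 *; set m := (size G1 + size G2)%N.
set t := map inl _ ++ _.
pose P : seq (nat + nat) := map inl (iota 0 p).
pose Q : seq (nat + nat) := map inl [seq (p + g)%N | g <- G1] ++ map inr G2.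
have tE : map seedpred t = P ++ Q.
  rewrite /t /P /Q !map_cat -!map_comp -catA (iotaDl 1 0) -map_comp.
  by congr (_ ++ (_ ++ _)); apply: eq_map => i.
have size_t : size t = (p + m)%N.
  by rewrite size_cat !size_map size_cat size_iota size_map addnA.
(* The kernel row moves below the seeds [0, ..., p - 1], which must come first for
   [det_rows_seed_prefix]. *)
have [b Hb] : exists b : bool, forall V : option (nat + nat) -> nat -> K,
    det_rows (map V (None :: map Some (P ++ Q))) =
    (-1) ^+ b * det_rows (map V (map Some P ++ None :: map Some Q)).
  apply: det_rows_perm.
  by rewrite map_cat -cat1s -[None :: map _ Q]cat1s perm_catCA.
pose w := \prod_(i <- t) seedwt a d i.
have w0 : w != 0.
  rewrite /w prodf_seq_neq0; apply/allP => i; rewrite mem_cat => /orP[] /mapP[f fG ->] /=.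
    rewrite mulf_neq0 // pnatr_eq0 -lt0n; move: fG; rewrite mem_cat mem_iota.
    by case/orP => [/andP[]//|/mapP[g _ ->]].
  by rewrite oppr_eq0 G2_neq0.
(* Row factors left by [p] differences; that of [None] is the Rodrigues constant. *)
pose e (i : option (nat + nat)) : K := match i with
  | None => (-1) ^+ (p + m) * (p`!)%:R * (1 - a) ^+ p * a ^+ m
  | Some (inl _) => 1
  | Some (inr _) => (a^-1 - 1) ^+ p end.
have e0 : \prod_(i <- Rindex G1 G2) e i != 0.
  rewrite prodf_seq_neq0; apply/allP => -[[g|g]|] _ /=.
  - exact: oner_neq0.
  - by rewrite expf_neq0 // subr_eq0 invr_eq1.
  - by rewrite !mulf_neq0 ?signr_eq0 ?factr_neq0 ?expf_neq0.
have c0 : \prod_(j < m.+1) a ^- j != 0.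
  by apply/prodf_neq0 => j _; rewrite invr_eq0 expf_neq0.
(* In order: seed weights, sign of the bidiagonal identity, sign of the row move, column factors,
   row factors. *)
exists (w^-1 * (-1) ^+ (p + m) * (-1) ^+ b *
  (\prod_(j < m.+1) a ^- j) * \prod_(i <- Rindex G1 G2) e i).
  by rewrite !mulf_neq0 ?invr_eq0 ?signr_eq0.
move=> x; apply: (mulfI w0); rewrite -det_rows_scale_rows.
set u := fun l => - x + l%:R : K.
set v := fun l => a * (- x + l%:R + d).
pose V i := if i is Some i then seedrow a (d + 1) (- x - 1) i else kappa u v (p + m).
have -> : [seq (fun j => seedwt a d i * seedrow a d (- x) i j) | i <- t] =
    [seq (fun l => u l * f l - v l * f l.+1) |
      f <- map (seedrow a (d + 1) (- x - 1)) (map seedpred t)].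
  rewrite -!map_comp; apply/eq_in_map => i it; apply: boolp.funext => l /=.
  rewrite seedrow_bidiagonal //; apply: contraTneq it => ->.
  rewrite mem_cat negb_or; apply/andP; split; apply/negP => /mapP[f] // + [fE].
  by rewrite -fE mem_cat mem_iota /= => /mapP[].
rewrite det_rows_bidiagonal !size_map size_t tE.
have -> : kappa u v (p + m) :: map (seedrow a (d + 1) (- x - 1)) (P ++ Q) =
    map V (None :: map Some (P ++ Q)).
  by rewrite /= -map_comp.
rewrite Hb map_cat -map_comp -map_comp det_rows_seed_prefix //.
have dE : d + 1 + p%:R = 2 - ct by rewrite /d; ring.
pose W i := match i with
  | None => iter p (@delta K) (kappa u v (p + m))
  | Some (inl g) => iter p (@delta K) (seedrow a (d + 1) (- x - 1) (inl (p + g)%N))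
  | Some (inr g) => iter p (@delta K) (seedrow a (d + 1) (- x - 1) (inr g)) end.
have -> : map (iter p (@delta K)) (map V (None :: map Some Q)) =
    map W (Rindex G1 G2).
  by rewrite /= /Q !map_cat -!map_comp.
(* Every row releases [a ^- j]; this is why [Rrow] has [a ^+ j] in the first family and no power of
   [a] in the second. *)
have -> : det_rows (map W (Rindex G1 G2)) =
    det_rows (map (fun i j => a ^- j * (e i * Rrow ct m p x i j)) (Rindex G1 G2)).
  apply: eq_det_rows => i j _.
  rewrite /= size_map size_cat !size_map -/m ltnS => jm.
  case: i => [[g|g]|]; rewrite /W.
  - rewrite iter_delta_seedrow_inl // dE /= mul1r mulKf //.
    by rewrite expf_neq0.
  - by rewrite iter_delta_seedrow_inr // dE /=; ring.
  - rewrite /u /v /d iter_delta_kappa //=; ring.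
rewrite (map_comp (fun f j => a ^- j * f j) (fun i j => e i * Rrow ct m p x i j)).
rewrite det_rows_scale_cols det_rows_scale_rows !size_map /= size_map size_cat !size_map -/m.
by rewrite !mulrA mulfV // mul1r.
Qed.

End DualReduction.

(** * The involution on index sets *)

Section Involution.
Local Open Scope nat_scope.

(** M_F + 1, the number of indices 0, ..., M_F; the value 0 on the empty set agrees with M = -1
    while staying in [nat]. *)
Definition fullsize (F : {fset nat}) : nat :=
  if F == fset0 then 0 else (\max_(f <- F) f).+1.

Lemma maxFE (F : {fset nat}) : maxF F = ((fullsize F)%:Z - 1)%R.
Proof. by rewrite /maxF /fullsize; case: eqP => // _; rewrite -addn1 PoszD GRing.addrK. Qed.

Lemma bigmax_mem (s : seq nat) : s != [::] -> \max_(f <- s) f \in s.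
Proof.
elim: s => // x [|y s] IH _; first by rewrite big_seq1 mem_head.
rewrite big_cons; case: (leqP x (\max_(f <- y :: s) f)) => _; last exact: mem_head.
by rewrite inE IH ?orbT.
Qed.

Lemma leq_max_fset (F : {fset nat}) f : f \in F -> f <= \max_(f <- F) f.
Proof. by move=> fF; apply: (@leq_bigmax_seq _ (enum_fset F) xpredT id). Qed.

Lemma mem_involF (F : {fset nat}) i :
  (i \in involF F) = (0 < i <= \max_(f <- F) f) && (\max_(f <- F) f - i \notin F).
Proof.
rewrite /involF; set M := \max_(f <- F) f.
rewrite in_fsetD !inE mem_iota add1n ltnS andbC; case: (boolP (0 < i <= M)) => //= /andP[i0 iM].
congr (~~ _); apply/imfsetP/idP => [[f /= fF ->]|MF].
  by rewrite subKn // leq_max_fset.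
by exists (M - i) => //=; rewrite subKn.
Qed.

(** The map g |-> M - g carries I(F) onto the gaps of F in 0, ..., M. *)
Lemma perm_incr_involF (F : {fset nat}) : (forall f, f \in F -> 0 < f) ->
  perm_eq (incr F ++ [seq (fullsize F).-1 - g | g <- incr (involF F)])
          (iota 0 (fullsize F)).
Proof.
move=> F_gt0; rewrite /fullsize; case: (eqVneq F fset0) => [->|F0].
  have -> : involF fset0 = fset0.
    by apply/fsetP => i; rewrite mem_involF big_seq_fset0 in_fset0; case: i.
  suff -> : incr fset0 = [::] by [].
  by apply/size0nil; rewrite size_sort cardfs0.
set M := \max_(f <- F) f; rewrite -[M.+1.-1]/M.
have MF : M \in F.
  by apply: bigmax_mem; rewrite -size_eq0 cardfs_eq0.
have leM f : f \in F -> f <= M by exact: leq_max_fset.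
have memG g : g \in incr (involF F) = (0 < g <= M) && (M - g \notin F).
  by rewrite mem_sort mem_involF.
apply: uniq_perm; rewrite ?iota_uniq //.
  rewrite cat_uniq sort_uniq fset_uniq /= map_inj_in_uniq ?sort_uniq ?fset_uniq ?andbT.
    apply/hasPn => i /mapP[g]; rewrite memG => /andP[_ gF] ->.
    by rewrite /= mem_sort.
  by move=> g h; rewrite !memG => /andP[/andP[_ gM] _] /andP[/andP[_ hM] _] E; rewrite -(subKn gM) E subKn.
move=> i; rewrite mem_cat mem_sort mem_iota add0n ltnS /=.
apply/orP/idP => [[/leM //|/mapP[g _ ->]]|iM]; first exact: leq_subr.
case: (boolP (i \in F)) => iF; [by left|right].
apply/mapP; exists (M - i); last by rewrite subKn.
rewrite memG leq_subr subKn // iF !andbT subn_gt0 ltn_neqAle iM andbT.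
(* [M] lies in [F], so [i] differs from [M] and [M - i] is positive. *)
by apply: contraNneq iF => ->.
Qed.

(** Adjoining [p + fullsize F] adds [p] gaps starting at [fullsize F]; reflected, they are 1, ...,
    p, and the old gaps become [p.+1 + g]. *)
Lemma perm_incr_involF_shift (F : {fset nat}) p : (forall f, f \in F -> 0 < f) ->
  perm_eq ((p + fullsize F) :: incr F ++
    [seq p + fullsize F - g | g <- iota 1 p ++ [seq p.+1 + g | g <- incr (involF F)]])
          (iota 0 (p + fullsize F).+1).
Proof.
move=> /perm_incr_involF; set s := fullsize F; set I := incr _; set G := incr _ => IG.
have -> : [seq p + s - g | g <- iota 1 p ++ [seq p.+1 + g | g <- G]] =
    rev (iota s p) ++ [seq s.-1 - g | g <- G].
  rewrite map_cat -map_comp; congr (_ ++ _).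
    apply: (@eq_from_nth _ 0); rewrite ?size_rev ?size_map ?size_iota // => i ip.
    rewrite (nth_map 0) ?size_iota // nth_rev ?size_iota // !nth_iota //; lia.
  by apply: eq_map => g /=; lia.
rewrite (_ : (p + s).+1 = s + (p + 1)); last by lia.
rewrite !iotaD; apply/seq.permP => P; have /seq.permP/(_ P) := IG.
rewrite /= !count_cat count_rev /= (addnC s p); rewrite add0n addn0; lia.
Qed.

End Involution.

Lemma involF_lt_fullsize (F : {fset nat}) g :
  g \in incr (involF F) -> (g < fullsize F)%N.
Proof.
rewrite mem_sort mem_involF /fullsize => /andP[/andP[g0 gM] _].
by case: eqP gM => // ->; rewrite big_seq_fset0 leqNgt g0.
Qed.

(** * Jacobi's identity for the seeds *)

Section ComplementaryMinors.
Variables (K : numFieldType) (a c : K).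
Hypotheses (a0 : a != 0) (a1 : a != 1).

(** The determinant of all seeds does not depend on [x], so [complementary_minors] becomes a
    proportionality with constant factor. *)
Lemma det_seeds_dual (s1 s2 : nat) (S T : seq (nat + nat)) : (0 < s1)%N ->
    perm_eq (S ++ T) (allseeds s1 s2) ->
  exists2 beta : K, beta != 0 & forall x,
    det_rows (map (seedrow a c x) S) = beta * det_rows (map (dualrow a c s1 s2 x) T).
Proof.
move=> s1_gt0 ST; have [b Hb] := det_rows_perm K ST.
have sizeST : (s1 + s2)%N = (size S + size T)%N.
  by rewrite -size_cat (perm_size ST) size_allseeds.
have s_gt0 : (0 < s1 + s2)%N by rewrite addn_gt0 s1_gt0.
have minors x : _ := @complementary_minors K _ (seedrow a c x) (dualrow a c s1 s2 x)
  (hank a s1 s2) S T _ sizeST.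
have {}minors x : det_rows (map (seedrow a c x) (S ++ T)) * det_rows (map (dualrow a c s1 s2 x) T) =
    (-1) ^+ (perm (@rev_ord_inj (size T))) * det_rows (map (seedrow a c x) S) /\
    det_rows (map (seedrow a c x) (S ++ T)) != 0.
  apply: minors => [j l _ _|e eN|]; first by rewrite (perm_big _ ST) pairing_seeds.
    by rewrite hankE ?ltn_eqF // ltnW.
  by rewrite hankE // eqxx.
have detE x : det_rows (map (seedrow a c x) (S ++ T)) =
    det_rows (map (seedrow a c 0) (S ++ T)).
  by rewrite !Hb det_allseeds_const.
exists ((-1) ^+ (perm (@rev_ord_inj (size T))) * det_rows (map (seedrow a c 0) (S ++ T))).
  by rewrite mulf_neq0 ?signr_eq0 //; case: (minors 0).
move=> x; case: (minors x) => + _; rewrite detE -mulrA => ->.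
by rewrite mulrA -expr2 sqrr_sign mul1r.
Qed.

End ComplementaryMinors.

(** * Assembly of the determinantal identity *)

Unset Implicit Arguments.

Theorem mainTheorem11 (R : realType) (a c : R) (F1 F2 : {fset nat})
    (a_neq0 : a != 0) (a_neq1 : a != 1)
    (c_nonpole : forall i : nat, c != - i%:R)
    (F1_pos : forall f : nat, f \in F1 -> (0 < f)%N)
    (F2_pos : forall f : nat, f \in F2 -> (0 < f)%N)
    (F_nonempty : ~ (F1 = fset0 /\ F2 = fset0))
    (Omega_neq0 : forall i : nat, OmegaF a c F1 F2 i%:R != 0)
    (n : int) (n_ge : vF F1 F2 <= n) :
  exists beta : R, beta != 0 /\
    forall x : R, meixnerF a c F1 F2 n x = beta * detR a c F1 F2 n x.
Proof.
set p := `|n - vF F1 F2|%N; set s1 := fullsize F1; set s2 := fullsize F2.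
(* This is n - u_F = (n - v_F) + M_{F1} + 1. *)
have nE : `|n - uF F1 F2|%N = (p + s1)%N.
  by move: n_ge; rewrite /p /vF maxFE -/s1; lia.
set G1 := incr (involF F1); set G2 := incr (involF F2).
set ct := ctilde c F1 F2.
have ctE : ct = c + (s1 + s2)%N%:R.
  by rewrite /ct /ctilde !maxFE -/s1 -/s2 !rmorphB /= natrD -!pmulrn; ring.
(* The parameter of the dual rows for families of sizes [(p + s1).+1] and [s2]. *)
pose d := 1 - ct - p%:R.
have dE : d = 2 - c - ((p + s1).+1 + s2)%N%:R.
  by rewrite /d ctE !natrD -[(p + s1).+1%:R]natr1 natrD; ring.
pose S : seq (nat + nat) :=
  map inl ((p + s1)%N :: incr F1) ++ map inr (incr F2).
pose t1 := iota 1 p ++ [seq (p.+1 + g)%N | g <- G1].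
pose T : seq (nat + nat) := map inl [seq (p + s1 - g)%N | g <- t1] ++
  map inr [seq (s2.-1 - g)%N | g <- G2].
have ST : perm_eq (S ++ T) (allseeds (p + s1).+1 s2).
  apply/seq.permP => P; rewrite /S /T /allseeds !count_cat !(count_map inl) !(count_map inr).
  have /seq.permP/(_ (preim inl P)) := perm_incr_involF_shift p F1_pos.
  have /seq.permP/(_ (preim inr P)) := perm_incr_involF F2_pos.
  by rewrite -/s1 -/s2 -/G1 -/G2 -/t1 -cat_cons !count_cat; lia.
have [b1 b1_neq0 Hb1] := det_seeds_dual c a_neq0 a_neq1 (ltn0Sn _) ST.
(* Here [d + g] is minus the sum of [c] and a natural number, nonzero by [c_nonpole]. *)
have G2_neq0 g : g \in G2 -> d + g%:R != 0.
  move/involF_lt_fullsize; rewrite -/s2 => gs.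
  suff -> : d + g%:R = - (c + (p + s1 + s2.-1 - g)%N%:R) by rewrite oppr_eq0 addr_eq0.
  have s2E : s2%:R = s2.-1%:R + 1 :> R by rewrite natr1 (ltn_predK gs).
  rewrite dE natrB; last by lia.
  by rewrite !natrD -[(p + s1).+1%:R]natr1 natrD s2E; ring.
have [b2 b2_neq0 Hb2] := det_dual_reduction a_neq0 a_neq1 G1 G2_neq0.
pose e (i : nat + nat) := if i is inl _ then wt1 a s2 else wt2 a (p + s1).+1 s2.
pose t : seq (nat + nat) := map inl t1 ++ map inr G2.
have e_neq0 : \prod_(i <- t) e i != 0.
  have a1' := subr1_neq0 a_neq1.
  rewrite prodf_seq_neq0; apply/allP => -[f|f] _ /=.
    by rewrite expf_neq0 // oppr_eq0 mulf_neq0 ?invr_eq0.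
  by rewrite mulf_neq0 ?expf_neq0 ?invr_eq0.
exists (b1 * ((\prod_(i <- t) e i) * b2)); split; first by rewrite !mulf_neq0.
move=> x.
have -> : meixnerF a c F1 F2 n x = det_rows (map (seedrow a c x) S).
  by rewrite /meixnerF nE /casorati_rows /S map_cat -!map_comp.
have -> : detR a c F1 F2 n x =
    det_rows (map (Rrow a ct (size G1 + size G2) p x) (Rindex G1 G2)).
  rewrite /detR -/ct -/p !size_sort /Rindex /=.
  by rewrite !map_cat -!map_comp.
rewrite Hb1 -!mulrA -Hb2 -det_rows_scale_rows; congr (_ * det_rows _).
(* The index reversal in [dualrow] undoes the one in [T]; the truncated subtractions are exact by
   [involF_lt_fullsize]. *)
rewrite /T /t [LHS]map_cat [RHS]map_cat -!map_comp; congr (_ ++ _);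
  apply/eq_in_map => g gG; apply: boolp.funext => l /=; rewrite -/d dE.
  rewrite subKn //; move: gG; rewrite mem_cat mem_iota => /orP[|/mapP[h]]; first by lia.
  by move/involF_lt_fullsize => + ->; rewrite -/s1; lia.
rewrite subKn; first by ring.
by move/involF_lt_fullsize: gG; rewrite -/s2; lia.
Qed.
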